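(* Let $K$ be a field, $S=K[x_1,\dots,x_n]$, $d\ge 2$, and ${\bf t}=(t_1,\dots,t_{d-1})$ a tuple of non-negative integers. Let $I\subseteq S$ be a ${\bf t}$-spread strongly stable ideal, and let $k\ge 0$ and $1\le\ell\le d$ be integers. The following conditions are equivalent: (i) $\beta_{k,k+\ell}(I)$ is an extremal Betti number of $I$; (ii) $\max\{\max(u):u\in G(I)_\ell\}=k+\sum_{j=1}^{\ell-1}t_j+1$ (in particular $G(I)_\ell\ne\emptyset$), and $\max(u)<k+\sum_{r=1}^{j-1}t_r+1$ for all $j>\ell$ and all $u\in G(I)_j$.
   Context: $S=K[x_1,\dots,x_n]$ is standard graded over a field $K$. Monomials are written $u=x_{j_1}x_{j_2}\cdots x_{j_\ell}$ with $1\le j_1\le j_2\le\cdots\le j_\ell\le n$. Such a monomial of degree $\ell\le d$ is called ${\bf t}$-spread if $j_{i+1}-j_i\ge t_i$ for $i=1,\dots,\ell-1$. A ${\bf t}$-spread monomial ideal is an ideal generated by ${\bf t}$-spread monomials (so its minimal generators have degree at most $d$). A ${\bf t}$-spread monomial ideal $I$ is ${\bf t}$-spread strongly stable if for every ${\bf t}$-spread monomial $u\in I$ and all $j<i$ such that $x_i$ divides $u$ and $x_j(u/x_i)$ is ${\bf t}$-spread, one has $x_j(u/x_i)\in I$. $G(I)$ denotes the unique minimal set of monomial generators of $I$, and $G(I)_j=\{u\in G(I):\deg(u)=j\}$. For a monomial $u\ne 1$, $\max(u)$ is the largest $i$ such that $x_i$ divides $u$. $\beta_{i,j}(I)=\dim_K\mathrm{Tor}^S_i(K,I)_j$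 are the graded Betti numbers. A graded Betti number $\beta_{k,k+\ell}(I)\neq 0$ is called extremal if $\beta_{i,i+j}(I)=0$ for all $i\ge k$, $j\ge\ell$ with $(i,j)\ne(k,\ell)$. *)

(* Defs.v *)
From HB Require Import structures.
From mathcomp Require Import all_boot all_order all_algebra.
From mathcomp.multinomials Require Export mpoly.
From Stdlib Require Import ClassicalEpsilon.

Set Implicit Arguments.
Unset Strict Implicit.
Unset Printing Implicit Defensive.

Import GRing.Theory.
Local Open Scope ring_scope.

(* Sets of monomials and ideals of S = {mpoly K[n]} are Prop-valued predicates.
   A monomial is its exponent vector u : 'X_{1..n}.  The variables
   x_1, ..., x_n are indexed by 'I_n, so that x_i is 'X_j with j = i - 1. *)

Definition ideal_gen (K : fieldType) (n : nat) (A : 'X_{1..n} -> Prop)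
    (p : {mpoly K[n]}) : Prop :=
  exists (r : nat) (q : 'I_r -> {mpoly K[n]}) (m : 'I_r -> 'X_{1..n}),
    (forall a, A (m a)) /\ p = \sum_(a < r) q a * 'X_[m a].

Definition generates (K : fieldType) (n : nat) (A : 'X_{1..n} -> Prop)
    (I : {mpoly K[n]} -> Prop) : Prop :=
  forall p, I p <-> ideal_gen A p.

Definition minimal_monomial_generators (K : fieldType) (n : nat)
    (I : {mpoly K[n]} -> Prop) (G : 'X_{1..n} -> Prop) : Prop :=
  generates G I /\
  forall G' : 'X_{1..n} -> Prop,
    (forall u, G' u -> G u) -> generates G' I -> forall u, G u -> G' u.

(* The nondecreasing sequence j_1 <= ... <= j_l of variable indices such that
   u = x_{j_1} ... x_{j_l}. *)
Definition mnm_word (n : nat) (u : 'X_{1..n}) : seq nat :=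
  flatten [seq nseq (u i) (val i) | i <- enum 'I_n].

(* The entry t_i of the tuple (t_1, ..., t_{d-1}) is nth 0 t (i - 1). *)
Definition tspread (n d : nat) (t : (d.-1).-tuple nat) (u : 'X_{1..n}) : Prop :=
  (mdeg u <= d)%N /\
  forall i, (i.+1 < size (mnm_word u))%N ->
    (nth 0 (mnm_word u) i + nth 0 t i <= nth 0 (mnm_word u) i.+1)%N.

Definition tspread_ideal (K : fieldType) (n d : nat) (t : (d.-1).-tuple nat)
    (I : {mpoly K[n]} -> Prop) : Prop :=
  exists A : 'X_{1..n} -> Prop, (forall u, A u -> tspread t u) /\ generates A I.

Definition tspread_strongly_stable (K : fieldType) (n d : nat)
    (t : (d.-1).-tuple nat) (I : {mpoly K[n]} -> Prop) : Prop :=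
  tspread_ideal t I /\
  forall (u : 'X_{1..n}) (i j : 'I_n),
    tspread t u -> I 'X_[u] -> (j < i)%N -> (0 < u i)%N ->
    tspread t (u - U_(i) + U_(j))%MM -> I 'X_[(u - U_(i) + U_(j))%MM].

(* 1-based; the value at the monomial 1 is 0. *)
Definition max_var (n : nat) (u : 'X_{1..n}) : nat :=
  \max_(i < n | (0 < u i)%N) i.+1.

(* Sum of the first m entries of t: t_1 + ... + t_m. *)
Definition tsum (d : nat) (t : (d.-1).-tuple nat) (m : nat) : nat :=
  (\sum_(0 <= i < m) nth 0 t i)%N.

(* A graded free resolution of K = S/(x_1, ..., x_n) by finitely generated free
   modules F_i = (+)_a S(- fr_shift i a).  Elements of F_i are row vectors, and
   F_{i+1} -> F_i is v |-> v *m fr_diff i.  On K, S acts through the constant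
   coefficient, so an S-linear map F_0 -> K is given by the images fr_aug of
   the generators. *)
Definition augment (K : fieldType) (n r : nat) (e : 'I_r -> K)
    (v : 'rV[{mpoly K[n]}]_r) : K :=
  \sum_(a < r) (v 0 a)@_0%MM * e a.

Record free_resolution (K : fieldType) (n : nat) := FreeResolution {
  fr_rank : nat -> nat;
  fr_shift : forall i, 'I_(fr_rank i) -> nat;
  fr_diff : forall i, 'M[{mpoly K[n]}]_(fr_rank i.+1, fr_rank i);
  fr_aug : 'I_(fr_rank 0) -> K;
  fr_diff_homog : forall i a b m, m \in msupp (fr_diff i a b) ->
    (mdeg m + fr_shift b)%N = fr_shift a;
  fr_aug_homog : forall a, fr_aug a != 0 -> fr_shift a = 0%N;
  fr_exact : forall i (v : 'rV[{mpoly K[n]}]_(fr_rank i.+1)),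
    v *m fr_diff i = 0 <-> exists w, v = w *m fr_diff i.+1;
  fr_exact0 : forall v : 'rV[{mpoly K[n]}]_(fr_rank 0),
    augment fr_aug v = 0 <-> exists w, v = w *m fr_diff 0;
  fr_surj : forall c : K,
    exists v : 'rV[{mpoly K[n]}]_(fr_rank 0), augment fr_aug v = c
}.

(* The degree j part of F_i (x)_S I, which is the direct sum of the
   I(- fr_shift i a): row vectors with entries in I. *)
Definition tensor_strand (K : fieldType) (n : nat) (F : free_resolution K n)
    (I : {mpoly K[n]} -> Prop) (i j : nat)
    (v : 'rV[{mpoly K[n]}]_(fr_rank F i)) : Prop :=
  forall a, I (v 0 a) /\
    forall m, m \in msupp (v 0 a) -> (mdeg m + fr_shift a)%N = j.

Definition in_kernel (K : fieldType) (n : nat) (F : free_resolution K n)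
    (i : nat) : 'rV[{mpoly K[n]}]_(fr_rank F i) -> Prop :=
  match i return 'rV[{mpoly K[n]}]_(fr_rank F i) -> Prop with
  | 0 => fun _ => True
  | i'.+1 => fun v => v *m fr_diff F i' = 0
  end.

Definition tor_cycle (K : fieldType) (n : nat) (F : free_resolution K n)
    (I : {mpoly K[n]} -> Prop) (i j : nat)
    (v : 'rV[{mpoly K[n]}]_(fr_rank F i)) : Prop :=
  tensor_strand I j v /\ in_kernel v.

Definition tor_boundary (K : fieldType) (n : nat) (F : free_resolution K n)
    (I : {mpoly K[n]} -> Prop) (i j : nat)
    (v : 'rV[{mpoly K[n]}]_(fr_rank F i)) : Prop :=
  exists2 w : 'rV[{mpoly K[n]}]_(fr_rank F i.+1),
    tensor_strand I j w & v = w *m fr_diff F i.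

(* dim_K (Z / B) = m for K-subspaces B of Z of an S-module: some family of m
   elements of Z induces a basis of Z / B.  Scalars of K act through the
   constants of S, since matrices over S only carry an S-module structure. *)
Definition quotient_dim (K : fieldType) (n : nat) (V : lmodType {mpoly K[n]})
    (Z B : V -> Prop) (m : nat) : Prop :=
  exists e : 'I_m -> V,
    [/\ forall a, Z (e a),
        forall c : 'I_m -> K,
          B (\sum_(a < m) (c a)%:MP *: e a) -> forall a, c a = 0
      & forall z, Z z ->
          exists c : 'I_m -> K, B (z - \sum_(a < m) (c a)%:MP *: e a)].

(* beta_{i,j}(I) = dim_K Tor_i(K, I)_j, where Tor_i(K, I) = H_i(F (x)_S I).
   The dimension is finite because each F_i is finitely generated, so epsilon
   does pick out the unique m that satisfies quotient_dim. *)
Definition betti (K : fieldType) (n : nat) (F : free_resolution K n)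
    (I : {mpoly K[n]} -> Prop) (i j : nat) : nat :=
  epsilon (inhabits 0%N)
    (quotient_dim (@tor_cycle K n F I i j) (@tor_boundary K n F I i j)).

Definition extremal_betti (K : fieldType) (n : nat) (F : free_resolution K n)
    (I : {mpoly K[n]} -> Prop) (k l : nat) : Prop :=
  betti F I k (k + l) <> 0%N /\
  forall i j, (k <= i)%N -> (l <= j)%N -> (i, j) <> (k, l) ->
    betti F I i (i + j) = 0%N.

(* Main.v *)
Require Import Defs.
From mathcomp Require Import all_boot all_order all_algebra zify.
From Stdlib Require Import ClassicalEpsilon.

Set Implicit Arguments.
Unset Strict Implicit.
Unset Printing Implicit Defensive.

Import GRing.Theory.

(** Order the generators of I by degree and then by the sum of their variable
    indices.  Then I has linear quotients: the colon ideal at a generator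
    u = x_{j_1} ... x_{j_l} is generated by the variables x_m that lie strictly
    below some j_s but at least at j_{s-1} + t_{s-1}, that is, by
    max(u) - 1 - (t_1 + ... + t_{l-1}) variables.  Since the degrees are
    nondecreasing, the connecting maps of the long exact Tor sequences of the
    filtration vanish for degree reasons, and since Tor_i(K, S/(x_a : a in V))
    is nonzero exactly in degree i for i <= |V|, beta_{i,i+j}(I) is nonzero if
    and only if i <= max(u) - 1 - (t_1 + ... + t_{j-1}) for some u in G(I)_j.
    Tor is computed with the given resolution F throughout, by diagram chases
    on elements of F tensored with quotients of monomial ideals. *)

(** * Vectors of polynomials with prescribed monomial supports *)

Section Support.
Local Open Scope ring_scope.
Variables (K : fieldType) (n : nat).
Implicit Types (p q : {mpoly K[n]}) (m u : 'X_{1..n}).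

Lemma classically_decidable (P : Prop) : {b : bool | P <-> b}.
Proof. by case: (excluded_middle_informative P) => h; [exists true|exists false]. Qed.

Lemma mpoly_split (P : 'X_{1..n} -> Prop) p :
  {q | forall m, (P m -> q@_m = p@_m) /\ (~ P m -> q@_m = 0)}.
Proof.
pose b m := sval (classically_decidable (P m)).
have bP m : P m <-> b m by exact: (svalP (classically_decidable (P m))).
exists (\sum_(m <- msupp p | b m) p@_m *: 'X_[m]) => m.
have -> : (\sum_(m' <- msupp p | b m') p@_m' *: 'X_[m'])@_m =
          if b m then p@_m else 0.
  rewrite raddf_sum /=; case: ifP => bm.
    rewrite [in RHS](mpolyE p) raddf_sum /= big_mkcond /=; apply: eq_bigr => m' _.
    rewrite mcoeffZ mcoeffX; case: eqP => [->|_]; first by rewrite bm.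
    by rewrite mulr0 if_same.
  apply: big1 => m' bm'; rewrite mcoeffZ mcoeffX; case: eqP => [e|_]; last exact: mulr0.
  by rewrite -e bm' in bm.
by split=> [/bP->|] // nP; case: ifP => // /bP.
Qed.

Lemma mpoly_divX u p :
  (forall m, m \in msupp p -> (u <= m)%MM) -> {q | p = 'X_[u] * q}.
Proof.
move=> h; exists (\sum_(m <- msupp p) p@_m *: 'X_[(m - u)%MM]).
rewrite {1}[p]mpolyE mulr_sumr; apply: eq_big_seq => m /h um.
by rewrite -scalerAr -mpolyXD addmC submK.
Qed.

Lemma msupp_mulX u p m : (m \in msupp ('X_[u] * p)) <-> 
  exists2 m', m' \in msupp p & m = (m' + u)%MM.
Proof.
split=> [hm|[m' hm' ->]].
  have := msuppM_le hm => /allpairsP [[a b]] /= []; rewrite msuppX inE => /eqP -> hb ->.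
  by exists b => //; rewrite addmC.
by move: hm'; rewrite !mcoeff_msupp mulrC addmC mcoeffMX.
Qed.

(** [Q] depends on the position [a] because the shift of each free generator enters the degree
    condition. *)
Definition suppd r (Q : 'I_r -> 'X_{1..n} -> Prop) (v : 'rV[{mpoly K[n]}]_r) :=
  forall a m, m \in msupp (v 0 a) -> Q a m.

Lemma suppdW r Q Q' (v : 'rV_r) :
  (forall a m, Q a m -> Q' a m) -> suppd Q v -> suppd Q' v.
Proof. by move=> h hv a m /hv /h. Qed.

Lemma suppd0 r Q : suppd Q (0 : 'rV_r).
Proof. by move=> a m; rewrite mxE -mpolyC0 msupp0. Qed.

Lemma suppdD r Q (v w : 'rV_r) : suppd Q v -> suppd Q w -> suppd Q (v + w).
Proof.
move=> hv hw a m; rewrite mxE => /msuppD_le; rewrite mem_cat => /orP [/hv|/hw]; exact.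
Qed.

Lemma suppdN r Q (v : 'rV_r) : suppd Q v -> suppd Q (- v).
Proof. by move=> hv a m; rewrite mxE (perm_mem (msuppN _)) => /hv. Qed.

Lemma suppdB r Q (v w : 'rV_r) : suppd Q v -> suppd Q w -> suppd Q (v - w).
Proof. by move=> hv hw; apply: suppdD => //; apply: suppdN. Qed.

Lemma suppd_mul r s Q Q' (v : 'rV_r) (D : 'M_(r, s)) :
  suppd Q v ->
  (forall a b m m', Q a m -> m' \in msupp (D a b) -> Q' b (m + m')%MM) ->
  suppd Q' (v *m D).
Proof.
move=> hv h b m; rewrite mxE => /msupp_sum_le /flattenP [s0 /mapP [a _ ->]].
move=> /msuppM_le /allpairsP [[x y]] /= [hx hy ->].
by apply: h hy; apply: hv hx.
Qed.

Lemma suppd_split r (Q Q1 Q2 : 'I_r -> 'X_{1..n} -> Prop) (v : 'rV_r) :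
  suppd Q v -> (forall a m, Q a m -> Q1 a m \/ Q2 a m) ->
  exists v1 v2, [/\ v = v1 + v2, suppd Q1 v1 & suppd Q2 v2].
Proof.
move=> hv h.
pose v1 : 'rV_r := \row_a sval (mpoly_split (Q1 a) (v 0 a)).
have v1P a m := svalP (mpoly_split (Q1 a) (v 0 a)) m.
exists v1, (v - v1); split; first by rewrite addrC subrK.
  move=> a m; rewrite mcoeff_msupp mxE.
  by case: (v1P a m) => _ h2; case: (classic (Q1 a m)) => // /h2 ->; rewrite eqxx.
move=> a m; rewrite mcoeff_msupp !mxE mcoeffB => hm.
case: (v1P a m) => h1 h2; case: (classic (Q1 a m)) => hQ.
  by rewrite (h1 hQ) subrr eqxx in hm.
have hmv : m \in msupp (v 0 a) by move: hm; rewrite (h2 hQ) subr0 mcoeff_msupp.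
by case: (h _ _ (hv _ _ hmv)).
Qed.

Lemma suppd_false r Q (v : 'rV_r) : (forall a m, ~ Q a m) -> suppd Q v -> v = 0.
Proof.
move=> h hv; apply/rowP => a; rewrite mxE; apply/mpolyP => m.
rewrite mcoeff0; apply/eqP; rewrite mcoeff_eq0; apply/negP => /hv; exact: h.
Qed.

Lemma suppd_divX r u (v : 'rV_r) :
  suppd (fun _ m => (u <= m)%MM) v -> exists v', v = 'X_[u] *: v'.
Proof.
move=> h; exists (\row_a sval (mpoly_divX (h a))).
by apply/rowP => a; rewrite !mxE -(svalP (mpoly_divX (h a))).
Qed.

Lemma suppd_mulX r Q u (v : 'rV_r) :
  suppd Q ('X_[u] *: v) <-> suppd (fun a m => Q a (m + u)%MM) v.
Proof.
split=> h a m.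
  move=> hm; apply: h; rewrite mxE; apply/msupp_mulX; by exists m.
by rewrite mxE => /msupp_mulX [m' /h hm' ->].
Qed.

End Support.

(** * Long exact Tor sequences for monomial ideals *)

Section RelativeTor.
Local Open Scope ring_scope.
Variables (K : fieldType) (n : nat) (F : free_resolution K n).
Implicit Types (A B C : 'X_{1..n} -> Prop) (i j : nat).

Local Notation r i := (fr_rank F i).
Local Notation vec i := 'rV[{mpoly K[n]}]_(r i).

(** The differential is extended by zero on F_0, so that cycles in all homological degrees are
    treated at once. *)
Definition dif i : vec i -> vec i.-1 :=
  match i return vec i -> vec i.-1 with
  | 0 => fun _ => 0
  | i'.+1 => fun v => v *m fr_diff F i'
  end.

Lemma difD i (v w : vec i) : dif (v + w) = dif v + dif w.
Proof. by case: i v w => [|i] v w /=; rewrite ?addr0 ?mulmxDl. Qed.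

Lemma difN i (v : vec i) : dif (- v) = - dif v.
Proof. by case: i v => [|i] v /=; rewrite ?oppr0 ?mulNmx. Qed.

Lemma difB i (v w : vec i) : dif (v - w) = dif v - dif w.
Proof. by rewrite difD difN. Qed.

Lemma difZ i c (v : vec i) : dif (c *: v) = c *: dif v.
Proof. by case: i v => [|i] v /=; rewrite ?scaler0 ?scalemxAl. Qed.

Lemma dif0 i : dif (0 : vec i) = 0.
Proof. by case: i => [|i] //=; rewrite mul0mx. Qed.

Lemma dif_dif i (w : vec i.+1) : dif (dif w : vec i) = 0.
Proof. by case: i w => [|i] w //=; apply/fr_exact; exists w. Qed.

Lemma dif_ker i (v : vec i.+1) : dif v = 0 -> exists w : vec i.+2, v = dif w.
Proof. by move=> h; apply/(@fr_exact _ _ F i v). Qed.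

Definition strand A i j : vec i -> Prop :=
  suppd (fun a m => A m /\ (mdeg m + fr_shift a)%N = j).

(** Chains with coefficients in A/B are handled through representatives: vectors over [A], those
    over [B] counting as zero. *)
Definition cyc A B i j (v : vec i) := strand A j v /\ strand B j (dif v).
Definition bnd A B i j (v : vec i) :=
  exists2 w : vec i.+1, strand A j w & strand B j (v - dif w).
(* Tor_i(K, A/B)_j = 0, for the monomial ideals spanned by the up-closed sets
   B <= A. *)
Definition tor_zero A B i j := forall v : vec i, cyc A B j v -> bnd A B j v.

Definition upclosed A := forall m m', A m -> A (m + m')%MM.
Definition subset_mon A B := forall m, A m -> B m.

Lemma strandW A B i j (v : vec i) : subset_mon A B -> strand A j v -> strand B j v.
Proof. by move=> h; apply: suppdW => a m [/h]. Qed.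

Lemma strand_dif A i j (v : vec i) : upclosed A -> strand A j v -> strand A j (dif v).
Proof.
case: i v => [|i] v hA hv; first exact: suppd0.
apply: suppd_mul hv _ => a b m m' [hm <-] hm'; split; first exact: hA.
by rewrite -(fr_diff_homog hm') mdegD addnA.
Qed.

Definition off_degree i j : vec i -> Prop :=
  suppd (fun a m => (mdeg m + fr_shift a)%N <> j).

Lemma off_degree_dif i j (v : vec i) : off_degree j v -> off_degree j (dif v).
Proof.
case: i v => [|i] v hv; first exact: suppd0.
apply: suppd_mul hv _ => a b m m' hm hm'.
by rewrite mdegD -addnA (fr_diff_homog hm').
Qed.

Lemma strand_off_degree A i j (v : vec i) : strand A j v -> off_degree j v -> v = 0.
Proof.
move=> h1 h2; apply: (@suppd_false _ _ _ (fun=> fun=> False)); first by move=> ? ? [].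
move=> a m hm.
by have [_ h] := h1 _ _ hm; have := h2 _ _ hm.
Qed.

Lemma degree_split i (Q : 'X_{1..n} -> Prop) j (v : vec i) :
  suppd (fun=> Q) v ->
  exists v1 v2, [/\ v = v1 + v2, strand Q j v1 & off_degree j v2].
Proof.
move=> h; apply: suppd_split h _ => a m hm.
by case: (eqVneq (mdeg m + fr_shift a)%N j) => [->|/eqP]; [left|right].
Qed.

(* Boundaries may be tested without controlling degrees: project to degree j. *)
Lemma bnd_ungraded A B i j (v : vec i) (w : vec i.+1) :
  upclosed B -> upclosed A -> subset_mon B A ->
  strand A j v -> suppd (fun=> A) w -> suppd (fun=> B) (v - dif w) ->
  bnd A B j v.
Proof.
move=> hB hA hBA hv hw hb.
have [w1 [w2 [ew hw1 hw2]]] := degree_split j hw.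
have [b1 [b2 [eb hb1 hb2]]] := degree_split j hb.
exists w1; first exact: hw1.
suff -> : v - dif w1 = b1 by [].
apply/eqP; rewrite -subr_eq0; apply/eqP; apply: (@strand_off_degree A _ j).
  apply: suppdB; last exact: strandW hb1.
  by apply: suppdB => //; apply: (@strand_dif A i.+1).
move: eb; rewrite ew difD => eb.
have -> : v - dif w1 - b1 = dif w2 + b2.
  move/eqP: eb; rewrite subr_eq => /eqP ->.
  by rewrite [dif w1 + _]addrC addrA addrK addrAC [b1 + b2]addrC addrK addrC.
by apply: suppdD => //; apply: (@off_degree_dif i.+1).
Qed.

Lemma bndW A B A' i j (v : vec i) : subset_mon A A' -> bnd A B j v -> bnd A' B j v.
Proof. by move=> h [w hw hb]; exists w => //; apply: strandW hw. Qed.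

Lemma cyc_dif A B C i j (w : vec i.+1) (c : vec i) :
  subset_mon C B -> strand B j (c + dif w) -> strand A j w -> strand C j c ->
  cyc A B j w.
Proof.
move=> hCB hcw hw hc; split => //.
rewrite -(addKr c (dif w)); apply: suppdD => //; apply: suppdN; exact: strandW hc.
Qed.

(** The hypothesis on [cyc B C] says that Tor_i(B/C) -> Tor_i(A/C) is zero in degree [j]; by
    exactness Tor_i(A/C) then embeds into Tor_i(A/B). *)
Lemma tor_zero_mid A B C i j : subset_mon C B -> upclosed A -> upclosed C ->
  (forall v : vec i, cyc B C j v -> bnd A C j v) ->
  tor_zero A B i j -> tor_zero A C i j.
Proof.
move=> hCB hA hC h1 h2 v [hv hdv].
have [|w hw hb] := h2 v; first by split=> //; apply: strandW hdv.
have [|w' hw' hc] := h1 (v - dif w).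
  by split=> //; rewrite difB dif_dif subr0.
exists (w + w'); first exact: suppdD.
by rewrite difD opprD addrA.
Qed.

(** When Tor_i(B/C) -> Tor_i(A/C) is zero, the connecting map from Tor_{i+1}(A/B) is onto
    Tor_i(B/C). *)
Lemma tor_zero_sub A B C i j : subset_mon C B -> subset_mon B A ->
  upclosed C ->
  (forall v : vec i, cyc B C j v -> bnd A C j v) ->
  tor_zero A B i.+1 j -> tor_zero B C i j.
Proof.
move=> hCB hBA hC h1 h2 v hv.
have [w hw hc] := h1 v hv.
have [|w' hw' hb] := h2 w.
  by apply: (cyc_dif hCB _ hw hc); rewrite subrK; case: hv.
exists (w - dif w'); first exact: hb.
by rewrite difB dif_dif subr0.
Qed.

(** In the long exact sequence Tor_i(A/B) stands between Tor_i(A/C) and Tor_{i-1}(B/C); for [i = 0]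
    the latter is absent. *)
Lemma tor_zero_quo A B C i j : subset_mon C B -> subset_mon B A -> upclosed A ->
  upclosed C -> upclosed B ->
  tor_zero A C i j -> (0 < i -> tor_zero B C i.-1 j)%N -> tor_zero A B i j.
Proof.
move=> hCB hBA hA hC hB h1 h2 v [hv hdv].
have [w hw hwc] : exists2 w : vec i, strand B j w & strand C j (dif v - dif w).
  case: i v h1 h2 hv hdv => [|i] v h1 h2 hv hdv.
    by exists 0; [apply: suppd0 | rewrite subrr; apply: suppd0].
  have [|w hw hc] := h2 isT (dif v); last by exists w.
  by split => //; rewrite (@dif_dif i); apply: suppd0.
have [|w' hw' hc'] := h1 (v - w).
  by split; [apply: suppdB => //; apply: strandW hw | rewrite difB].
exists w' => //; have -> : v - dif w' = (v - w - dif w') + w by rewrite addrAC subrK.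
by apply: suppdD => //; apply: strandW hc'.
Qed.

(** * Colon ideals by a monomial *)

Lemma strand_union_principal A B u i j (v : vec i) :
  (forall m, A m <-> B m \/ (u <= m)%MM) -> strand A (j + mdeg u) v ->
  exists (v' b : vec i), [/\ v = 'X_[u] *: v' + b, strand (fun=> True) j v'
    & strand B (j + mdeg u) b].
Proof.
move=> hA hv.
have [v1 [b [-> hv1 hb]]] : exists v1 b, [/\ v = v1 + b,
    strand (fun m => (u <= m)%MM) (j + mdeg u) v1 & strand B (j + mdeg u) b].
  by apply: suppd_split hv _ => a m [/hA [] hm e]; [right|left].
have [|v' ev] := @suppd_divX _ _ _ u v1; first by apply: suppdW hv1 => a m [].
exists v', b; split=> //; first by rewrite ev.
move: hv1; rewrite ev => /suppd_mulX; apply: suppdW => a m [_].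
by rewrite mdegD => e; split => //; lia.
Qed.

Lemma strand_mulX A B u i j (v : vec i) : (forall m, B m <-> A (m + u)%MM) ->
  strand A (j + mdeg u) ('X_[u] *: v) <-> strand B j v.
Proof.
move=> h; rewrite /strand suppd_mulX; split; apply: suppdW => a m [/h hm].
  by rewrite mdegD; split=> //; lia.
by move=> <-; split=> //; rewrite mdegD; lia.
Qed.

Lemma strand_mulX_union A B u i j (v : vec i) :
  (forall m, A m <-> B m \/ (u <= m)%MM) ->
  strand (fun=> True) j v -> strand A (j + mdeg u) ('X_[u] *: v).
Proof.
move=> hA hv; apply/(@strand_mulX A (fun=> True)) => // m; split=> // _.
by apply/hA; right; apply: lem_addl.
Qed.

(* If A = B + (u) and L = B : u, then A/B is isomorphic to S/L shifted by deg u. *)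
Lemma tor_zero_colon A B L u i j : upclosed B ->
  (forall m, A m <-> B m \/ (u <= m)%MM) ->
  (forall m, L m <-> B (m + u)%MM) ->
  tor_zero A B i (j + mdeg u) <-> tor_zero (fun=> True) L i j.
Proof.
move=> hB hA hL; split=> h v [hv hdv].
  have [|w hw hb] := h ('X_[u] *: v).
    split; first exact: strand_mulX_union hv.
    by rewrite difZ; apply/(strand_mulX _ _ hL).
  have [w' [b [ew hw' hb']]] := strand_union_principal hA hw.
  exists w'; first exact: hw'.
  apply/(strand_mulX _ _ hL).
  rewrite scalerBr -[_ *: dif w'](@difZ i.+1) -(addrK b ('X_[u] *: w')) -ew difB opprB addrA.
  by rewrite addrAC; apply: suppdD => //; apply: (@strand_dif B i.+1).
have [v' [b [ev hv' hb]]] := strand_union_principal hA hv.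
have [|w hw hl] := h v'.
  split=> //; apply/(strand_mulX _ _ hL).
  rewrite -difZ -(addrK b ('X_[u] *: v')) -ev difB.
  by apply: suppdB => //; apply: strand_dif.
exists ('X_[u] *: w); first exact: strand_mulX_union hw.
rewrite ev difZ addrAC -scalerBr; apply: suppdD => //.
by apply/(strand_mulX _ _ hL).
Qed.

(** Multiples of [u] have degree at least [mdeg u] and shifts are natural numbers, so in lower
    degrees a strand over [A] already lies over [B]. *)
Lemma tor_zero_colon_low A B u i j :
  (forall m, A m <-> B m \/ (u <= m)%MM) ->
  (j < mdeg u)%N -> tor_zero A B i j.
Proof.
move=> hA hj v [hv _]; exists 0; first exact: suppd0.
rewrite dif0 subr0; apply: suppdW hv => a m [/hA hm e]; split=> //.
case: hm => // um; move: hj; rewrite -e -(submK um) mdegD; lia.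
Qed.

(** * Ideals generated by variables *)

Lemma mulmx_factor p q s (M : 'M[{mpoly K[n]}]_(p, s)) (D : 'M_(q, s)) :
  (forall a, exists w, row a M = w *m D) -> exists T, M = T *m D.
Proof.
move=> h; pose w a := constructive_indefinite_description _ (h a).
exists (\matrix_(a, b) sval (w a) 0 b).
apply/row_matrixP => a; rewrite row_mul (svalP (w a)); congr (_ *m _).
by apply/rowP => b; rewrite !mxE.
Qed.

(* Multiplication by a variable acts as zero on K, hence is null-homotopic on F. *)
Lemma mulX_nullhomotopic (x : 'I_n) i :
  exists (S : 'M_(r i, r i.+1)) (S' : 'M_(r i.-1, r i)), forall v : vec i,
    'X_x *: v = dif (v *m S) + dif v *m S'.
Proof.
elim: i => [|i [S [S' h]]].
  have [|S hS] := @mulmx_factor _ _ _ ('X_x)%:M (fr_diff F 0).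
    move=> a; apply/fr_exact0/big1 => b _.
    by rewrite !mxE mcoeffMn mcoeffX mnm1_eq0 mul0rn mul0r.
  exists S, 0 => v.
  by rewrite mulmx0 addr0 /= -mulmxA -hS mul_mx_scalar.
(* The homotopy identity one step down, applied to [dif] of a basis vector, shows that the rows of
   this matrix are cycles; they lift by exactness, and the old [S] becomes the new [S']. *)
have [|T hT] := @mulmx_factor _ _ _ (('X_x)%:M - fr_diff F i *m S) (fr_diff F i.+1).
  move=> a; apply/fr_exact; set v := row a _.
  have -> : v = 'X_x *: delta_mx 0 a - dif (delta_mx 0 a) *m S.
    by rewrite /v rowE mulmxBr mul_mx_scalar mulmxA.
  have := h (dif (delta_mx 0 a : vec i.+1)); rewrite dif_dif mul0mx addr0 => h'.
  by rewrite -/(@dif i.+1 _) difB difZ h' subrr.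
exists T, S => v.
by rewrite /= -mulmxA -hT mulmxBr mul_mx_scalar mulmxA subrK.
Qed.

(** The variable is a nonzerodivisor modulo [C], so a cycle of B/C is ['X_x *: v'] modulo [C] with
    [dif v'] over [C]; the homotopy for multiplication by the variable bounds it in S/C. Hence
    Tor_i(B/C) -> Tor_i(S/C) is zero. *)
Lemma bnd_mulX B C (x : 'I_n) i j (v : vec i) : upclosed C ->
  (forall m, B m <-> C m \/ (U_(x) <= m)%MM) ->
  (forall m, C m <-> C (m + U_(x))%MM) ->
  cyc B C j v -> bnd (fun=> True) C j v.
Proof.
move=> hC hB hCx [hv hdv]; case: j hv hdv => [|j] hv hdv.
  exists 0; first exact: suppd0.
  rewrite dif0 subr0; apply: suppdW hv => a m [/hB hm e]; split=> //.
  by case: hm => // um; move: e; rewrite -(submK um) mdegD mdeg1; lia.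
rewrite -(addn1 j) -(mdeg1 x) in hv hdv *.
have [v' [c [ev hv' hc]]] := strand_union_principal hB hv.
have [S [S' hS]] := mulX_nullhomotopic x i.
have hdv' : strand C j (dif v').
  apply/(strand_mulX _ _ hCx); rewrite -difZ -(addrK c ('X_x *: v')) -ev difB.
  by apply: suppdB => //; apply: strand_dif.
apply: (@bnd_ungraded _ _ _ _ _ (v' *m S)) => //.
- by apply: strandW hv.
rewrite ev addrAC hS [dif _ + _]addrC addrK; apply: suppdD.
  by apply: suppd_mul hdv' _ => a b m m' [hm _] _; apply: hC.
by apply: suppdW hc => a m [].
Qed.

Lemma tor_zero_free i j : tor_zero (fun=> True) (fun=> False) i j <->
  ~ (j = i /\ i = 0)%N.
Proof.
have st0 i' (v : vec i') : strand (fun=> False) j v -> v = 0.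
  by apply: suppd_false => a m [].
case: i => [|i]; last first.
  split=> [_ [_ //]|_ v [hv /st0 /dif_ker [w ev]]].
  by apply: (@bnd_ungraded _ _ _ _ _ w) => //; rewrite ev subrr; apply: suppd0.
split=> [h [ej _]|hj v [hv _]]; last first.
  have /fr_exact0 [w ev] : augment (@fr_aug _ _ F) v = 0.
    apply: big1 => a _; case: (eqVneq (@fr_aug _ _ F a) 0) => [->|]; first by rewrite mulr0.
    move/fr_aug_homog => ea; apply/eqP; rewrite mulf_eq0 mcoeff_eq0.
    apply/orP; left; apply/negP => /hv [_]; rewrite ea mdeg0; lia.
  by apply: (@bnd_ungraded _ _ _ _ _ w) => //; rewrite ev subrr; apply: suppd0.
(* The degree 0 part of a preimage of 1 still augments to 1, because only generators of shift 0
   contribute; it is a cycle but no boundary, as boundaries augment to 0. *)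
have [v ev] := @fr_surj _ _ F 1.
have [|v1 [v2 [e12 hv1 hv2]]] := @degree_split 0 (fun=> True) j v; first by [].
have [|w _ /st0 /eqP] := h v1; first by split=> //; apply: suppd0.
rewrite subr_eq0 => /eqP e1.
have /eqP : augment (@fr_aug _ _ F) v1 = 0 by apply/fr_exact0; exists w.
suff -> : augment (@fr_aug _ _ F) v1 = 1 by rewrite oner_eq0.
rewrite -ev e12; apply: eq_bigr => a _; rewrite mxE mcoeffD.
case: (eqVneq (@fr_aug _ _ F a) 0) => [->|]; first by rewrite !mulr0.
move/fr_aug_homog => ea; suff -> : (v2 0 a)@_0 = 0 by rewrite addr0.
by apply/eqP; rewrite mcoeff_eq0; apply/negP => /hv2; rewrite ea mdeg0 ej.
Qed.

Definition varideal (V : seq nat) (m : 'X_{1..n}) : Prop :=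
  exists2 x : 'I_n, val x \in V & (0 < m x)%N.

Lemma varideal_up V : upclosed (varideal V).
Proof. by move=> m m' [x hx hm]; exists x => //; rewrite mnmDE; lia. Qed.

Lemma varideal_cons (x : 'I_n) V m :
  varideal (val x :: V) m <-> varideal V m \/ (U_(x) <= m)%MM.
Proof.
rewrite lep1mP -lt0n; split=> [[y]|].
  by rewrite inE => /orP [/eqP /val_inj ->|hy hm]; [right|left; exists y].
by move=> [[y hy hm]|hm]; [exists y; rewrite // inE hy orbT|exists x; rewrite // inE eqxx].
Qed.

Lemma varideal_addU (x : 'I_n) V m : val x \notin V ->
  varideal V m <-> varideal V (m + U_(x))%MM.
Proof.
move=> hx; split=> [/varideal_up //|[y hy]].
rewrite mnmDE mnm1E; case: (eqVneq x y) => [e|_]; first by rewrite e hy in hx.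
by rewrite addn0 => hm; exists y.
Qed.

Lemma tor_zeroW A A' B B' i j : (forall m, A m <-> A' m) -> (forall m, B m <-> B' m) ->
  tor_zero A B i j -> tor_zero A' B' i j.
Proof.
move=> hA hB h v [hv hdv].
have [|w hw hb] := h v.
  by split; [apply: strandW hv => m /hA|apply: strandW hdv => m /hB].
by exists w; [apply: strandW hw => m /hA|apply: strandW hb => m /hB].
Qed.

(* Tor_i(K, S/(x_a : a in V)) is the i-th exterior power of K^V, in degree i. *)
Lemma tor_zero_varideal V i j : uniq V -> all (fun x => x < n)%N V ->
  tor_zero (fun=> True) (varideal V) i j <-> ~ (j = i /\ i <= size V)%N.
Proof.
elim: V i j => [|x V IH] i j.
  move=> _ _; rewrite leqn0 -(rwP eqP) -tor_zero_free.
  by split; apply: tor_zeroW => // m; split=> // -[].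
move=> /= /andP [xV uV] /andP [xn aV].
have {}IH i j := IH i j uV aV.
pose C := varideal V; pose B := varideal (x :: V); pose y := Ordinal xn.
have hB m : B m <-> C m \/ (U_(y) <= m)%MM by apply: (@varideal_cons y).
have hCy m : C m <-> C (m + U_(y))%MM by apply: (@varideal_addU y).
have hC : upclosed C := @varideal_up V.
have zero i' (v : vec i') : cyc B C j v -> bnd (fun=> True) C j v.
  exact: (@bnd_mulX _ _ y).
have hCB : subset_mon C B by move=> m hm; apply/hB; left.
have hBT : subset_mon B (fun=> True) by [].
have hT : upclosed (fun=> True) by [].
(* B/C is S/C shifted by one degree, so the induction hypothesis applies; [j = 0] is kept apart
   because [j.-1] is truncated. *)
have BC i' : tor_zero B C i' j <-> (j = 0 \/ (0 < j /\ ~ (j.-1 = i' /\ i' <= size V)))%N.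
  case: (posnP j) => [->|j0].
    split=> _; first by left.
    by apply: (tor_zero_colon_low hB); rewrite mdeg1.
  rewrite -{1}(prednK j0) -(addn1 j.-1) -(mdeg1 y) (tor_zero_colon _ _ hC hB hCy) IH.
  split=> [h|[|[_ h]] //]; [right; split=> //|lia].
(* As Tor_i(B/C) -> Tor_i(S/C) vanishes, the long exact sequence breaks into short ones, which
   amount to Pascal's rule. *)
have -> : tor_zero (fun=> True) B i j <->
    tor_zero (fun=> True) C i j /\ (0 < i -> tor_zero B C i.-1 j)%N.
  split=> [h|[h1 h2]]; last exact: (tor_zero_quo hCB hBT hT hC (@varideal_up _) h1 h2).
  split; first exact: (tor_zero_mid hCB hT hC (zero i) h).
  case: i h => // i h _; exact: (tor_zero_sub hCB hBT hC (zero i) h).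
rewrite IH BC; case: i => [|i] /=; lia.
Qed.

(** * Tor of ideals with linear quotients *)

Definition upset (gs : seq 'X_{1..n}) m := exists2 u, u \in gs & (u <= m)%MM.

Lemma upset_up gs : upclosed (upset gs).
Proof.
by move=> m m' [u hu um]; exists u => //; apply: lepm_trans um (lem_addr _ _).
Qed.

(* The list is traversed from its end: each colon ideal is taken with respect to
   the ideal of the entries that follow. *)
Fixpoint linear_quotients (V : 'X_{1..n} -> seq nat) (gs : seq 'X_{1..n}) : Prop :=
  if gs is u :: gs' then
    [/\ uniq (V u), all (fun x => x < n)%N (V u),
        (forall v, v \in gs' -> (mdeg v <= mdeg u)%N),
        (forall m, varideal (V u) m <-> upset gs' (m + u)%MM) &
        linear_quotients V gs']
  else True.

Lemma tor_zero_linear_quotients V gs i j : linear_quotients V gs ->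
  tor_zero (upset gs) (fun=> False) i j <->
  forall u, u \in gs -> ~ (j = i + mdeg u /\ i <= size (V u))%N.
Proof.
elim: gs i j => [|u gs IH] i j /=.
  move=> _; split=> // _ v [hv _]; exists 0; first exact: suppd0.
  by rewrite dif0 subr0; apply: suppdW hv => a m [[]].
move=> [uV aV hdeg hcol /IH {}IH].
set A := upset (u :: gs); pose B := upset gs; pose C (m : 'X_{1..n}) := False.
have hB : upclosed B := @upset_up _; have hA : upclosed A := @upset_up _.
have hC : upclosed C by [].
have hAB m : A m <-> B m \/ (u <= m)%MM.
  split=> [[v]|[[v hv vm]|um]].
  - by rewrite inE => /orP [/eqP ->|hv vm]; [right|left; exists v].
  - by exists v => //; rewrite inE hv orbT.
  - by exists u => //; rewrite inE eqxx.
have hBA : subset_mon B A by move=> m hm; apply/hAB; left.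
have hCB : subset_mon C B by [].
(* A/B is S modulo the variables in [V u], shifted by [mdeg u], so its Tor_i lives only in degree
   [i + mdeg u]. *)
have AB i' : tor_zero A B i' j <-> ~ (j = i' + mdeg u /\ i' <= size (V u))%N.
  case: (leqP (mdeg u) j) => hj.
    rewrite -{1}(subnK hj) (tor_zero_colon _ _ hB hAB hcol) tor_zero_varideal //.
    by move: (mdeg u) (size (V u)) hj => a b hj; split; lia.
  by split=> _; [lia|apply: tor_zero_colon_low hAB _].
have BC i' : (forall v, v \in gs -> j = i' + mdeg v -> False)%N -> tor_zero B C i' j.
  by move=> h; apply/IH => v /h hv [].
(* Tor_{i-1}(B) lives in degrees [i - 1 + mdeg v] with [mdeg v <= mdeg u], strictly below
   [i + mdeg u]. So the connecting map from Tor_i(A/B) is zero, and vanishing of Tor_i(A) is tested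
   on the two outer terms. *)
have -> : tor_zero A C i j <-> tor_zero B C i j /\ tor_zero A B i j.
  split=> [h|[h1 h2]].
    split.
      case: (classic (j = i.+1 + mdeg u)%N) => [ej|nj].
        by apply: BC => v /hdeg; lia.
      apply: (tor_zero_sub hCB hBA hC).
        by move=> v [hv hdv]; apply: h; split=> //; apply: strandW hv.
      by apply/AB => -[].
    case: (classic (j = i + mdeg u)%N) => [ej|nj]; last by apply/AB => -[].
    apply: (tor_zero_quo hCB hBA hA hC hB h) => i0.
    by apply: BC => v /hdeg; lia.
  by apply: (tor_zero_mid hCB hA hC) h2 => v /h1 /(bndW hBA).
rewrite IH AB; split=> [[h1 h2] v|h].
  by rewrite inE => /orP [/eqP -> //|/h1].
by split=> [v hv|]; apply: h; rewrite inE ?eqxx // hv orbT.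
Qed.

End RelativeTor.

(** * Finite dimension of Tor and vanishing Betti numbers *)

Section FiniteDimension.
Local Open Scope ring_scope.
Variables (K : fieldType) (n : nat).

Lemma quotient_dim0 (V : lmodType {mpoly K[n]}) (Z B : V -> Prop) :
  quotient_dim Z B 0 <-> forall z, Z z -> B z.
Proof.
split=> [[e [_ _ h]] z /h [c]|h]; first by rewrite big_ord0 subr0.
exists (fun=> 0); split=> [[]|c _ []|z /h hz] //.
by exists (fun=> 0); rewrite big_ord0 subr0.
Qed.

Lemma quotient_dim_eq0 (V : lmodType {mpoly K[n]}) (Z B : V -> Prop) m :
  (forall z, Z z -> B z) -> quotient_dim Z B m -> m = 0%N.
Proof.
case: m => // m h [e [he hind _]].
have := hind (fun a => (a == ord0)%:R).
rewrite big_ord_recl big1 => [|a _]; last by rewrite mpolyC0 scale0r.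
rewrite addr0 eqxx mpolyC1 scale1r => /(_ (h _ (he _)) ord0) /eqP.
by rewrite oner_eq0.
Qed.

(** By [hinj], a family in [Z] independent modulo [B] has linearly independent images under [phi],
    hence at most [N] members; a family of maximal size also spans. *)
Lemma quotient_dim_exists (V : lmodType {mpoly K[n]}) (Z B : V -> Prop)
    N (phi : V -> 'rV[K]_N) :
  (forall c v, B v -> B (c%:MP *: v)) ->
  (forall m (c : 'I_m -> K) e, phi (\sum_a (c a)%:MP *: e a) = \sum_a c a *: phi (e a)) ->
  (forall m (c : 'I_m -> K) e, (forall a, Z (e a)) ->
     phi (\sum_a (c a)%:MP *: e a) = 0 -> B (\sum_a (c a)%:MP *: e a)) ->
  exists m, quotient_dim Z B m.
Proof.
move=> hB hphi hinj.
pose indep m := exists2 e : 'I_m -> V, forall a, Z (e a) &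
  forall c : 'I_m -> K, B (\sum_a (c a)%:MP *: e a) -> forall a, c a = 0.
pose b m := sval (classically_decidable (indep m)).
have bP m : indep m <-> b m := svalP (classically_decidable (indep m)).
have hN m : b m -> (m <= N)%N.
  move=> /bP [e he hind]; pose M := \matrix_a phi (e a).
  suff /eqP <- : row_free M by apply: rank_leq_col.
  apply: inj_row_free => v hv; apply/rowP => a; rewrite mxE.
  apply: hind; apply: hinj => //; rewrite hphi -[RHS]hv mulmx_sum_row.
  by apply: eq_bigr => a' _; rewrite rowK.
have b0 : exists m, b m by exists 0%N; apply/bP; exists (fun=> 0) => [[]|c _ []].
case: (ex_maxnP b0 hN) => m /bP [e he hind] hmax.
exists m, e; split=> // z hz.
pose e' (a : 'I_m.+1) := if unlift ord0 a is Some a' then e a' else z.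
have e'0 : e' ord0 = z by rewrite /e' unlift_none.
have e'S a : e' (lift ord0 a) = e a by rewrite /e' liftK.
case: (classic (forall c : 'I_m.+1 -> K, B (\sum_a (c a)%:MP *: e' a) ->
         forall a, c a = 0)) => [hind'|].
  have /hmax : b m.+1; last by rewrite ltnn.
  by apply/bP; exists e' => // a; rewrite /e'; case: unlift.
move/not_all_ex_not => -[c hc0]; have [hc hne] := imply_to_and _ _ hc0.
have {}hc : B ((c ord0)%:MP *: z + \sum_a (c (lift ord0 a))%:MP *: e a).
  move: hc; rewrite big_ord_recl e'0.
  by under eq_bigr => a _ do rewrite e'S.
case: (eqVneq (c ord0) 0) => c0.
  case: hne => a; move: hc; rewrite c0 mpolyC0 scale0r add0r => /hind h.
  by case: (unliftP ord0 a) => [a' ->|->].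
exists (fun a => - ((c ord0)^-1 * c (lift ord0 a))).
move/(hB (c ord0)^-1): hc.
rewrite scalerDr scalerA -mpolyCM mulVf // mpolyC1 scale1r scaler_sumr -sumrN.
under eq_bigr => a _ do rewrite scalerA -mpolyCM -[_%:MP *: _]opprK -scaleNr -mpolyCN.
by [].
Qed.

(** [epsilon] returns an actual dimension only if one exists, so finite-dimensionality has to be
    established along the way. *)
Lemma betti_eq0 (F : free_resolution K n) (I : {mpoly K[n]} -> Prop)
    (A : 'X_{1..n} -> Prop) i j :
  (forall p, I p <-> forall m, m \in msupp p -> A m) ->
  betti F I i j = 0%N <-> tor_zero F A (fun=> False) i j.
Proof.
move=> hI.
have strandE i' (v : 'rV_(fr_rank F i')) : tensor_strand I j v <-> strand A j v.
  split=> [h a m hm|h a]; first by have [/hI hA hd] := h a; split; auto.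
  by split; [apply/hI => m /h []|move=> m /h []].
have strand0 i' (v : 'rV_(fr_rank F i')) : strand (fun=> False) j v <-> v = 0.
  split=> [|->]; last exact: suppd0.
  by apply: suppd_false => a m [].
have cycE v : tor_cycle I j v <-> cyc A (fun=> False) j (v : 'rV_(fr_rank F i)).
  rewrite /tor_cycle /cyc strandE; case: i v => [|i] v /=.
    by split=> -[h1 _]; split=> //; apply: suppd0.
  by rewrite (strand0 i).
have bndE v : tor_boundary I j v <-> bnd A (fun=> False) j (v : 'rV_(fr_rank F i)).
  split=> -[w /strandE hw h]; exists w => //; apply/strand0 + move/strand0: h.
    by rewrite h subrr.
  by move/eqP; rewrite subr_eq0 => /eqP.
have -> : tor_zero F A (fun=> False) i j <->
    forall v, @tor_cycle _ _ F I i j v -> @tor_boundary _ _ F I i j v.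
  by split=> h v /cycE /h /bndE.
have [m hm] : exists m, quotient_dim (@tor_cycle _ _ F I i j) (@tor_boundary _ _ F I i j) m.
  (* As shifts are nonnegative, the coefficients at monomials of degree at most [j] determine a
     vector of the strand. *)
  pose T : finType := ('I_(fr_rank F i) * 'X_{1..n < j.+1})%type.
  pose phi (v : 'rV[{mpoly K[n]}]_(fr_rank F i)) : 'rV[K]_#|T| :=
    \row_k (v 0 (enum_val k).1)@_(bmnm (enum_val k).2).
  apply: (@quotient_dim_exists _ _ _ _ phi).
  - move=> c v [w hw ->]; exists (c%:MP *: w); last by rewrite scalemxAl.
    move=> a; rewrite mxE mul_mpolyC; have [/hI hA hd] := hw a.
    by split; [apply/hI => m /msuppZ_le /hA|move=> m /msuppZ_le /hd].
  - move=> m c e; apply/rowP => k; rewrite mxE !summxE raddf_sum /=.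
    by apply: eq_bigr => a _; rewrite !mxE mcoeffCM.
  - move=> m c e he h0; exists 0.
      by apply/strandE; apply: suppd0.
    rewrite mul0mx; set v := (X in X = 0); rewrite -/v in h0.
    have hv : strand A j v.
      rewrite /v; elim/big_rec: _ => [|a v' _ hv']; first exact: suppd0.
      apply: suppdD => // b m'; rewrite mxE mul_mpolyC => /msuppZ_le.
      by case: (he a) => /strandE h _ /h.
    apply/rowP => a; rewrite mxE; apply/mpolyP => m'; rewrite mcoeff0.
    apply/eqP; rewrite mcoeff_eq0; apply/negP => hm'.
    have [_ hd] := hv _ _ hm'.
    have hlt : (mdeg m' < j.+1)%N by lia.
    have := congr1 (fun x : 'rV_#|T| => x 0 (enum_rank ((a, BMultinom hlt) : T))) h0.
    by rewrite !mxE enum_rankK /= => /eqP; rewrite mcoeff_eq0 hm'.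
have := epsilon_spec (inhabits 0%N) _ (ex_intro _ m hm).
rewrite -/(betti F I i j) => hb; split=> [e0|h]; last exact: quotient_dim_eq0 hb.
by move: hb; rewrite e0 => /quotient_dim0.
Qed.

End FiniteDimension.

(** * Spread words and their free variables *)

Section Words.
Implicit Types (t v w : seq nat) (lo s x : nat).

(* The smallest value that position s of a spread word may take, given the
   entries before it. *)
Definition lower_bound lo t w s :=
  if s is s'.+1 then nth 0 w s' + nth 0 t s' else lo.

Definition spread_word lo t w :=
  forall s, s < size w -> lower_bound lo t w s <= nth 0 w s.

(** The gap between the lower bound of an entry and the entry itself consists of the smaller values
    that may replace it; for a generator, these are the variables of its colon ideal. The parameter
    [lo] lets the recursion pass to the tail. *)
Fixpoint free_vars lo t w : seq nat :=
  if w is a :: w' then iota lo (a - lo) ++ free_vars (a + head 0 t) (behead t) w'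
  else [::].

Lemma spread_word_cons lo t a w :
  spread_word lo t (a :: w) <->
  lo <= a /\ spread_word (a + head 0 t) (behead t) w.
Proof.
split=> [h|[h1 h2]].
  split=> [|s hs]; first exact: (h 0).
  have := h s.+1 hs; case: s {hs} => [|s] /=; first by rewrite nth0.
  by rewrite nth_behead.
case=> [|s] //= hs; have := h2 s hs.
by case: s {hs} => [|s] /=; rewrite ?nth0 ?nth_behead.
Qed.

Lemma mem_free_vars lo t w x : x \in free_vars lo t w <->
  exists2 s, s < size w & lower_bound lo t w s <= x < nth 0 w s.
Proof.
elim: w lo t => [|a w IH] lo t /=; first by split=> [|[]].
rewrite mem_cat mem_iota; split=> [/orP [h|/IH [s hs h]]|[[|s] hs h]].
- by exists 0 => //=; lia.
- exists s.+1 => //=; move: h.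
  by case: s {hs} => [|s] /=; rewrite ?nth0 ?nth_behead.
- by move: h => /= h; apply/orP; left; lia.
- apply/orP; right; apply/IH; exists s => //; move: h => /=.
  by case: s {hs} => [|s] /=; rewrite ?nth0 ?nth_behead.
Qed.

Lemma free_vars_ge lo t w x : spread_word lo t w -> x \in free_vars lo t w -> lo <= x.
Proof.
elim: w lo t => [|a w IH] lo t //= /spread_word_cons [h1 h2].
by rewrite mem_cat mem_iota => /orP [|/(IH _ _ h2)]; lia.
Qed.

Lemma free_vars_uniq lo t w : spread_word lo t w -> uniq (free_vars lo t w).
Proof.
elim: w lo t => [|a w IH] lo t //= /spread_word_cons [h1 h2].
rewrite cat_uniq iota_uniq IH // andbT /=; apply/hasPn => x /(free_vars_ge h2).
by rewrite mem_iota; lia.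
Qed.

(** The gap lengths and the spreads alternate between [lo] and the last entry, so their sum
    telescopes. *)
Lemma size_free_vars lo t w : spread_word lo t w -> w != [::] ->
  size (free_vars lo t w) + lo + \sum_(0 <= i < (size w).-1) nth 0 t i = last 0 w.
Proof.
elim: w lo t => [|a w IH] lo t //= /spread_word_cons [h1 h2] _.
rewrite size_cat size_iota; case: w IH h2 => [|b w] IH h2.
  by rewrite /= big_geq //; lia.
have := IH _ _ h2 isT; set f := size (free_vars _ _ _).
rewrite /= big_nat_recl //= -nth0; under eq_bigr => i _ do rewrite nth_behead.
lia.
Qed.

Lemma spread_word_sorted lo t w : spread_word lo t w -> sorted leq w.
Proof. by move=> h; apply/(sortedP 0) => i hi; have /= := h _ hi; lia. Qed.

Lemma spread_word_take lo t w k : spread_word lo t w -> spread_word lo t (take k w).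
Proof.
move=> h s; rewrite size_take => hs.
have {}hs : s < size w /\ s < k by move: hs; case: ifP; lia.
rewrite nth_take; last by case: hs.
have := h s; case: s hs => [|s] [] /= h1 h2; first exact.
by rewrite nth_take; [exact|lia].
Qed.

Lemma sumn_set_nth w s x : s < size w -> x < nth 0 w s ->
  sumn (set_nth 0 w s x) < sumn w.
Proof.
move=> hs hx; rewrite set_nthE hs -[X in _ < sumn X](cat_take_drop s w) (drop_nth 0 hs).
by rewrite !sumn_cat /=; lia.
Qed.

Lemma pointwise_sumn_eq v w : size v = size w ->
  (forall s, s < size w -> nth 0 w s <= nth 0 v s) -> sumn v <= sumn w -> v = w.
Proof.
have sumn_le v' w' : size v' = size w' ->
    (forall s, s < size w' -> nth 0 w' s <= nth 0 v' s) -> sumn w' <= sumn v'.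
  elim: v' w' => [|a v' IH] [|b w'] //= [hs] h.
  by have := h 0 isT; have := IH _ hs (fun s => h s.+1) => /=; lia.
elim: v w => [|a v IH] [|b w] //= [hs] h hsum.
have h0 := h 0 isT; have hS s := h s.+1; rewrite /= in h0 hS.
have hle := sumn_le _ _ hs hS.
by rewrite (IH w hs hS); [congr cons|]; lia.
Qed.

(** Let m be the entry of [v] at its first drop [s] below [w]. Sortedness keeps m out of [w] from
    [s] on, and any earlier m in [w] is matched by one in [v] at the same place; the m at position
    [s] of [v] is extra. *)
Lemma count_first_drop v w s : s < size v -> s < size w -> sorted leq w -> sorted leq v ->
  nth 0 v s < nth 0 w s -> (forall r, r < s -> nth 0 w r <= nth 0 v r) ->
  count_mem (nth 0 v s) w < count_mem (nth 0 v s) v.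
Proof.
move=> hv hw sw sv hlt hge.
have [m em] : exists m, m = nth 0 v s by exists (nth 0 v s).
rewrite -em in hlt *.
rewrite -{1}(cat_take_drop s w) -{1}(cat_take_drop s.+1 v) !count_cat.
rewrite (take_nth 0 hv) -em -cats1 count_cat /= eqxx.
have -> : count_mem m (drop s w) = 0.
  apply/count_memPn/negP => /(nthP 0) [r]; rewrite size_drop nth_drop => hr e.
  have := sorted_leq_nth leq_trans leqnn 0 sw s (s + r).
  rewrite !inE e => /(_ hw); have -> : s + r < size w by rewrite -ltn_subRL.
  by rewrite leq_addr => /(_ isT isT); rewrite leqNgt hlt.
suff : count_mem m (take s w) <= count_mem m (take s v) 
  by rewrite !addn0 addn1 addSn ltnS => h; apply: leq_trans h (leq_addr _ _).
rewrite -!(map_nth_iota0 0) ?(ltnW hv) ?(ltnW hw) // !count_map -!sum1_count.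
rewrite big_mkcond [leqRHS]big_mkcond /= big_seq [leqRHS]big_seq.
apply: leq_sum => r; rewrite mem_iota /= add0n => hr.
case: eqP => // e; have -> : nth 0 v r == m; last by [].
have := sorted_leq_nth leq_trans leqnn 0 sv r s; rewrite !inE -em hv (ltn_trans hr hv).
rewrite (ltnW hr) => /(_ isT isT isT) h2.
by rewrite eqn_leq h2 -e hge.
Qed.

End Words.

(** * Strongly stable sets of words *)

Section StableWords.
Variables (t : seq nat) (n d : nat) (J : seq nat -> Prop).
Implicit Types (v w : seq nat).

Definition spread_monomial w :=
  [/\ size w <= d, all (fun x => x < n) w & spread_word 0 t w].

Hypothesis J_stable : forall w s x, spread_monomial w -> J w -> s < size w ->
  x < nth 0 w s -> spread_monomial (set_nth 0 w s x) -> J (set_nth 0 w s x).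

Lemma spread_monomial_replace w s x : spread_monomial w -> s < size w ->
  lower_bound 0 t w s <= x < nth 0 w s -> spread_monomial (set_nth 0 w s x).
Proof.
move=> [h1 h2 h3] hs hx.
have hsz : size (set_nth 0 w s x) = size w.
  by rewrite size_set_nth; apply/maxn_idPr.
split; first by rewrite hsz.
  apply/(all_nthP 0) => r; rewrite hsz nth_set_nth /= => hr.
  have /(all_nthP 0) h := h2; case: eqP => _; last exact: h.
  by have := h _ hs; lia.
move=> r; rewrite hsz nth_set_nth /= => hr; have := h3 _ hr.
case: eqP => [->|ne] {hr}; first by case: s hx {hs hsz} => [|s] /= hx;
  rewrite ?nth_set_nth /= ?ltn_eqF //; lia.
case: r ne => [|r] //= ne; rewrite nth_set_nth /=; case: eqP => [->|_] //; lia.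
Qed.

(** Stability passes from single replacements to entrywise domination by replacing the entries of
    [v] one at a time from the left. *)
Lemma dominated_stable v w : spread_monomial v -> J v -> spread_monomial w ->
  size w = size v -> (forall s, s < size v -> nth 0 w s <= nth 0 v s) -> J w.
Proof.
move=> [hv1 /(all_nthP 0) hv2 hv3] Jv [hw1 /(all_nthP 0) hw2 hw3] hsz hle.
(* A prefix of [w] followed by the rest of [v] is spread: at the junction, the entry of [w] is at
   most the entry of [v] that it replaces. *)
pose mix k := mkseq (fun i => if i < k then nth 0 w i else nth 0 v i) (size v).
have sp k : spread_monomial (mix k).
  split; first by rewrite size_mkseq.
    apply/(all_nthP 0) => s; rewrite size_mkseq => hs; rewrite nth_mkseq //.
    by case: ifP => _; [apply: hw2; rewrite hsz|apply: hv2].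
  move=> s; rewrite size_mkseq => hs.
  rewrite nth_mkseq //; case: s hs => [//|s] hs; rewrite /= nth_mkseq ?(ltnW hs) //.
  have /= h1 := hw3 s.+1; rewrite hsz in h1; have {}h1 := h1 hs.
  have /= h2 := hv3 s.+1 hs; have h3 := hle _ hs; have h4 := hle _ (ltnW hs).
  by case: (ltngtP s.+1 k) => h; case: (ltngtP s k) => h'; lia.
have Jmix k : k <= size v -> J (mix k).
  elim: k => [|k IH] hk.
    suff -> : mix 0 = v by [].
    by apply: (@eq_from_nth _ 0); rewrite size_mkseq // => i hi; rewrite nth_mkseq.
  have {}IH := IH (ltnW hk).
  have e : mix k.+1 = set_nth 0 (mix k) k (nth 0 w k).
    have sz : size (set_nth 0 (mix k) k (nth 0 w k)) = size v.
      by rewrite size_set_nth size_mkseq; apply/maxn_idPr.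
    apply: (@eq_from_nth _ 0); rewrite size_mkseq // => i hi.
    rewrite nth_set_nth /= !nth_mkseq // ltnS leq_eqVlt.
    by case: eqP => [->|].
  case: (ltngtP (nth 0 w k) (nth 0 v k)) => hk'.
  - rewrite e; apply: J_stable => //; first by rewrite size_mkseq.
      by rewrite nth_mkseq // ltnn.
    by rewrite -e.
  - by have := hle _ hk; lia.
  - suff -> : mix k.+1 = mix k by [].
    apply: (@eq_from_nth _ 0); rewrite !size_mkseq // => i hi.
    rewrite !nth_mkseq // ltnS leq_eqVlt.
    by case: eqP => [->|] //=; rewrite ltnn.
suff -> : w = mix (size v) by exact: Jmix.
apply: (@eq_from_nth _ 0) => [|i]; rewrite hsz ?size_mkseq // => hi.
by rewrite nth_mkseq // hi.
Qed.

End StableWords.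

(** * Monomials as sorted words *)

Section MonomialWords.
Variable n : nat.
Implicit Types (u m : 'X_{1..n}) (w : seq nat).

Definition mnm_of_word w : 'X_{1..n} := [multinom count_mem (val i) w | i < n].

Lemma count_mnm_word u (i : 'I_n) : count_mem (val i) (mnm_word u) = u i.
Proof.
rewrite /mnm_word count_flatten -map_comp sumnE big_map big_enum /= (bigD1 i) //=.
rewrite count_nseq /= eqxx mul1n big1 ?addn0 // => j ji.
by rewrite count_nseq /= (inj_eq val_inj) (negbTE ji).
Qed.

Lemma mnm_word_lt u : all (fun x => x < n) (mnm_word u).
Proof.
apply/allP => x /flattenP [s /mapP [i _ ->]].
by rewrite mem_nseq => /andP [_ /eqP ->]; apply: ltn_ord.
Qed.

Lemma mnm_word_sorted u : sorted leq (mnm_word u).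
Proof.
rewrite sorted_pairwise; last exact: leq_trans.
have : pairwise leq (map val (enum 'I_n)).
  by rewrite val_enum_ord -sorted_pairwise ?iota_sorted //; exact: leq_trans.
rewrite /mnm_word; elim: (enum 'I_n) => //= i s IH /andP [h1 h2].
rewrite pairwise_cat IH // andbT; apply/andP; split.
  apply/allrelP => x y; rewrite mem_nseq => /andP [_ /eqP ->].
  move=> /flattenP [s' /mapP [j hj ->]]; rewrite mem_nseq => /andP [_ /eqP ->].
  by move/allP: h1; apply; apply: map_f.
elim: (u i) => //= k ->; rewrite andbT; apply/allP => x.
by rewrite mem_nseq => /andP [_ /eqP ->].
Qed.

Lemma mnm_wordK u : mnm_of_word (mnm_word u) = u.
Proof. by apply/mnmP => i; rewrite mnmE count_mnm_word. Qed.

Lemma mnm_of_wordK w : sorted leq w -> all (fun x => x < n) w ->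
  mnm_word (mnm_of_word w) = w.
Proof.
move=> sw aw; apply: (sorted_eq leq_trans anti_leq) => //; first exact: mnm_word_sorted.
apply/allP => x; rewrite mem_cat => hx /=; have xn : x < n.
  by case/orP: hx => [/(allP (mnm_word_lt _))|/(allP aw)].
by rewrite -[x]/(val (Ordinal xn)) count_mnm_word mnmE.
Qed.

Lemma size_mnm_word u : size (mnm_word u) = mdeg u.
Proof.
rewrite /mnm_word size_flatten /shape -map_comp sumnE big_map big_enum /= mdegE.
by apply: eq_bigr => i _; rewrite /= size_nseq.
Qed.

Lemma mem_mnm_word u (i : 'I_n) : (val i \in mnm_word u) = (0 < u i).
Proof. by rewrite -count_mnm_word -has_count has_pred1. Qed.

Lemma mnm_of_word_set_nth w s x (hx : x < n) (hs : s < size w)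
    (hw : nth 0 w s < n) :
  mnm_of_word (set_nth 0 w s x) =
  (mnm_of_word w - U_(Ordinal hw) + U_(Ordinal hx))%MM.
Proof.
apply/mnmP => i; rewrite set_nthE hs mnmDE mnmBE !mnmE.
rewrite -{3}(cat_take_drop s w) (drop_nth 0 hs) !count_cat /=.
rewrite -!(inj_eq val_inj) /=; lia.
Qed.

(** The word is sorted, and its entries are 0-based whereas [max_var] is 1-based. *)
Lemma max_varE u : 0 < mdeg u -> max_var u = (last 0 (mnm_word u)).+1.
Proof.
rewrite -size_mnm_word => hu; set w := mnm_word u in hu *.
have hl : last 0 w \in w by case: (w) hu => //= a s _; apply: mem_last.
apply/eqP; rewrite eqn_leq; apply/andP; split.
  apply/bigmax_leqP => i; rewrite -mem_mnm_word -/w => /(nthP 0) [r hr <-].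
  rewrite ltnS -nth_last.
  apply: (sorted_leq_nth leq_trans leqnn 0 (mnm_word_sorted u)).
  - by rewrite inE.
  - by rewrite inE ltn_predL.
  - by rewrite -ltnS prednK.
have ln : last 0 w < n := allP (mnm_word_lt u) _ hl.
rewrite /max_var; apply: (@leq_bigmax_cond _ (fun i : 'I_n => 0 < u i) _ (Ordinal ln)).
by rewrite -mem_mnm_word.
Qed.

Lemma lepm_mdeg_eq u m : (u <= m)%MM -> mdeg m <= mdeg u -> u = m.
Proof.
move=> um; rewrite -{1 2}(submK um) mdegD => h.
have /eqP -> : (m - u == 0)%MM by rewrite -mdeg_eq0; lia.
by rewrite add0m.
Qed.

Lemma lepm_mdeg u m : (u <= m)%MM -> mdeg u <= mdeg m.
Proof. by move=> um; rewrite -(submK um) mdegD leq_addl. Qed.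

Lemma sumn_mnm_word u : sumn (mnm_word u) <= n * mdeg u.
Proof.
rewrite -size_mnm_word; have := mnm_word_lt u; elim: (mnm_word u) => //= x w IH.
by move=> /andP [xn /IH]; lia.
Qed.

End MonomialWords.

(** * Monomial generators of ideals *)

Section Generators.
Local Open Scope ring_scope.
Variables (K : fieldType) (n : nat) (I : {mpoly K[n]} -> Prop).
Implicit Types (u v m : 'X_{1..n}).

Lemma ideal_gen_msupp (A : 'X_{1..n} -> Prop) p :
  @ideal_gen K n A p <->
  forall m, m \in msupp p -> exists2 u, A u & (u <= m)%MM.
Proof.
split=> [[r [q [a [hA ->]]]] m|h].
  move=> /msupp_sum_le /flattenP [s /mapP [b _ ->]]; rewrite mulrC.
  by move=> /msupp_mulX [m' _ ->]; exists (a b) => //; apply: lem_addl.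
have h' (b : 'I_(size (msupp p))) :
    {u | A u /\ (u <= nth 0%MM (msupp p) b)%MM}.
  apply: constructive_indefinite_description.
  by have [|u] := h (nth 0%MM (msupp p) b); [apply: mem_nth|exists u].
exists (size (msupp p)),
  (fun b : 'I_(size (msupp p)) => p@_(nth 0%MM (msupp p) b) *:
     'X_[nth 0%MM (msupp p) b - sval (h' b)]),
  (fun b : 'I_(size (msupp p)) => sval (h' b)); split=> [b|]; first by case: (svalP (h' b)).
rewrite {1}[p]mpolyE (big_nth 0%MM) big_mkord; apply: eq_bigr => b _.
by rewrite -scalerAl -mpolyXD submK //; case: (svalP (h' b)).
Qed.

Lemma generates_mem A u : @generates K n A I -> A u -> I 'X_[u].
Proof.
move=> hA Au; apply/hA/ideal_gen_msupp => m; rewrite msuppX inE => /eqP ->.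
by exists u => //; apply: lepm_refl.
Qed.

Lemma generates_memX A m : @generates K n A I ->
  I 'X_[m] <-> exists2 u, A u & (u <= m)%MM.
Proof.
move=> hA; rewrite (hA _) ideal_gen_msupp; split=> [|h m'].
  by apply; rewrite msuppX inE.
by rewrite msuppX inE => /eqP ->.
Qed.

Lemma generates_msupp A p : @generates K n A I ->
  I p <-> forall m, m \in msupp p -> I 'X_[m].
Proof.
move=> hA; rewrite (hA p) ideal_gen_msupp.
by split=> h m /h /(generates_memX _ hA).
Qed.

Variable G : 'X_{1..n} -> Prop.
Hypothesis hG : minimal_monomial_generators I G.

(** If [u] properly divided [v], discarding [v] would leave a generating set, against minimality. *)
Lemma minimal_generators_antichain u v : G u -> G v -> (u <= v)%MM -> u = v.
Proof.
case: hG => gG minG Gu Gv uv; apply/eqP/contraT => /eqP nuv.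
pose G' w := G w /\ w <> v.
suff [_ []] : G' v by [].
apply: minG (Gv) => [w []|p] //; rewrite (gG p) !ideal_gen_msupp.
split=> h m /h [w Gw wm]; last by exists w => //; case: Gw.
case: (classic (w = v)) => [e|ne]; last by exists w.
by exists u; [split|apply: lepm_trans uv _; rewrite -e].
Qed.

(** A generator [u] is a multiple of some [a] in [A], itself a multiple of some [g] in [G]; the
    antichain property forces all three to agree. This carries spreadness from [A] to [G]. *)
Lemma minimal_generators_sub A u : generates A I -> G u -> A u.
Proof.
move=> hA Gu; have gG := proj1 hG.
have /(generates_memX _ hA) [a Aa au] := generates_mem gG Gu.
have /(generates_memX _ gG) [g Gg ga] := generates_mem hA Aa.
have e := minimal_generators_antichain Gg Gu (lepm_trans ga au).
rewrite e in ga; suff -> : u = a by [].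
by apply: lepm_mdeg_eq => //; apply: lepm_mdeg.
Qed.

End Generators.

(** * Linear quotients of strongly stable spread ideals *)

Section SpreadIdeal.
Local Open Scope nat_scope.
Variables (K : fieldType) (n d : nat) (t : (d.-1).-tuple nat).
Variables (I : {mpoly K[n]} -> Prop) (G : 'X_{1..n} -> Prop).
Hypothesis hI : tspread_strongly_stable t I.
Hypothesis hG : minimal_monomial_generators I G.
Implicit Types (u v m : 'X_{1..n}) (w : seq nat).

Let J w := I 'X_[mnm_of_word n w].

Lemma tspreadE u : tspread t u <-> spread_monomial t n d (mnm_word u).
Proof.
split=> [[h1 h2]|[h1 h2 h3]]; split; rewrite -?size_mnm_word //.
- by rewrite size_mnm_word.
- exact: mnm_word_lt.
- by case=> [|s] //= hs; apply: h2.
- by move=> s /h3.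
Qed.

Lemma tspread_stable_word w s x : spread_monomial t n d w -> J w -> s < size w ->
  x < nth 0 w s -> spread_monomial t n d (set_nth 0 w s x) -> J (set_nth 0 w s x).
Proof.
move=> sw Jw hs hx sw'; have [_ aw rw] := sw; have [_ _ rw'] := sw'.
have hw : nth 0 w s < n by apply: (allP aw); apply: mem_nth.
have wK := mnm_of_wordK (spread_word_sorted rw) aw.
have w'K := mnm_of_wordK (spread_word_sorted rw') (let: And3 _ h _ := sw' in h).
rewrite /J (mnm_of_word_set_nth (ltn_trans hx hw) hs hw).
apply: (proj2 hI) => //.
- by apply/tspreadE; rewrite wK.
- by rewrite mnmE -has_count has_pred1; apply: mem_nth.
- by rewrite -(mnm_of_word_set_nth (ltn_trans hx hw) hs hw); apply/tspreadE; rewrite w'K.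
Qed.

Lemma generator_tspread u : G u -> tspread t u.
Proof. by case: hI => -[A [hA gA]] _ /(minimal_generators_sub hG gA) /hA. Qed.

Lemma generator_spread u : G u -> spread_monomial t n d (mnm_word u).
Proof. by move=> /generator_tspread /tspreadE. Qed.

Lemma generator_mdeg u : G u -> mdeg u <= d.
Proof. by move=> /generator_tspread []. Qed.

Definition generator_vars u := free_vars 0 t (mnm_word u).

(* Orders the generators by degree, then by the sum of the variable indices;
   the latter is at most n * d. *)
Definition weight u := mdeg u * (n * d).+1 + sumn (mnm_word u).

Lemma weight_lt_mdeg u v : G v -> mdeg v < mdeg u -> weight v < weight u.
Proof.
move=> /generator_mdeg hv huv.
have h1 : sumn (mnm_word v) < (n * d).+1.
  by rewrite ltnS (leq_trans (sumn_mnm_word v)) // leq_mul2l hv orbT.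
rewrite /weight (@leq_trans ((mdeg v).+1 * (n * d).+1)) //.
  by rewrite mulSn addnC ltn_add2r.
by rewrite (leq_trans _ (leq_addr _ _)) // leq_mul2r huv orbT.
Qed.

Lemma weight_le_mdeg u v : G u -> weight v <= weight u -> mdeg v <= mdeg u.
Proof.
move=> Gu huv; rewrite leqNgt; apply/negP => /(weight_lt_mdeg Gu); lia.
Qed.

(** Replacing a suitable entry of [u] by [x] stays in the ideal by stability. A generator [v]
    dividing the result has smaller weight: either its degree is smaller, or it is the result
    itself, whose index sum is smaller. *)
Lemma colon_vars_lower u m : G u -> varideal (generator_vars u) m ->
  exists v, [/\ G v, weight v < weight u & (v <= m + u)%MM].
Proof.
move=> Gu [x hx hm]; have su := generator_spread Gu.
have [hu1 hu2 hu3] := su; set w := mnm_word u in su hu1 hu2 hu3.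
have [s hs hsx] : exists2 s, s < size w & lower_bound 0 t w s <= x < nth 0 w s.
  exact/mem_free_vars.
have hxw : x < nth 0 w s by case/andP: hsx.
have hw : nth 0 w s < n by apply: (allP hu2); apply: mem_nth.
have sw' := spread_monomial_replace su hs hsx; have [_ aw' rw'] := sw'.
have Ju : J w by rewrite /J mnm_wordK; apply: generates_mem Gu; apply: (proj1 hG).
have := tspread_stable_word su Ju hs hxw sw'.
move=> /(generates_memX _ (proj1 hG)) [v Gv vw'].
have w'K := mnm_of_wordK (spread_word_sorted rw') aw'.
have ew' := mnm_of_word_set_nth (ltn_ord x) hs hw.
have hdeg : mdeg (mnm_of_word n (set_nth 0 w s x)) = mdeg u.
  by rewrite -!size_mnm_word w'K size_set_nth -/w; apply/maxn_idPr.
exists v; split=> //.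
  case: (ltngtP (mdeg v) (mdeg u)) => h; first exact: weight_lt_mdeg.
    by have := lepm_mdeg vw'; rewrite hdeg leqNgt h.
  have -> : v = mnm_of_word n (set_nth 0 w s x).
    by apply: lepm_mdeg_eq => //; rewrite hdeg h.
  by rewrite /weight w'K hdeg ltn_add2l; apply: sumn_set_nth.
apply: lepm_trans vw' _; rewrite ew' mnm_wordK; apply/mnm_lepP => i.
rewrite !mnmDE mnmBE !mnm1E [leqRHS]addnC leq_add ?leq_subr //.
by case: eqP => // <-; rewrite (_ : Ordinal _ = x) //; apply: val_inj.
Qed.

(** At the first position where [v] drops below [u], the entry of [v] is a free variable of [u] and
    occurs more often in [v] than in [u], hence occurs in [m]. *)
Lemma colon_vars_upper u v m : G u -> G v -> v <> u -> weight v <= weight u ->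
  (v <= m + u)%MM -> varideal (generator_vars u) m.
Proof.
move=> Gu Gv nvu hvu vmu; have su := generator_spread Gu; have sv := generator_spread Gv.
have [hu1 hu2 hu3] := su; have [hv1 hv2 hv3] := sv.
have hdeg := weight_le_mdeg Gu hvu.
have hsz : size (mnm_word v) <= size (mnm_word u) by rewrite !size_mnm_word.
pose P s := (s < size (mnm_word v)) && (nth 0 (mnm_word v) s < nth 0 (mnm_word u) s).
case: (classic (exists s, P s)) => [exP|nP].
  case: (ex_minnP exP) => s /andP [hs hlt] hmin.
  have hge r : r < s -> nth 0 (mnm_word u) r <= nth 0 (mnm_word v) r.
    move=> hr; rewrite leqNgt; apply/negP => h.
    have : s <= r by apply: hmin; rewrite /P h (ltn_trans hr hs).
    by rewrite leqNgt hr.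
  have hx : nth 0 (mnm_word v) s < n by apply: (allP hv2); apply: mem_nth.
  exists (Ordinal hx).
    apply/mem_free_vars; exists s; first exact: leq_trans hsz.
    rewrite hlt andbT; have := hv3 s hs; case: s hs hlt hmin hge hx => [|s] //= hs _ _ hge _ h.
    by have := hge s (ltnSn s); lia.
  have := count_first_drop hs (leq_trans hs hsz) (mnm_word_sorted u) (mnm_word_sorted v) hlt hge.
  have /mnm_lepP /(_ (Ordinal hx)) := vmu; rewrite mnmDE.
  have := count_mnm_word u (Ordinal hx); have := count_mnm_word v (Ordinal hx) => /= -> ->.
  lia.
have hle s : s < size (mnm_word v) -> nth 0 (mnm_word u) s <= nth 0 (mnm_word v) s.
  by move=> hs; rewrite leqNgt; apply/negP => h; apply: nP; exists s; rewrite /P hs h.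
(* Without a drop, [v] dominates a prefix of [u]. Equal lengths force [v = u], since the index sum
   of [v] is no larger; a shorter [v] puts a proper prefix of [u] in the ideal, against the
   minimality of [u]. *)
case: (ltngtP (size (mnm_word v)) (size (mnm_word u))) => hlt; last first.
- case: nvu; rewrite -(mnm_wordK v) -(mnm_wordK u); congr mnm_of_word.
  apply: pointwise_sumn_eq => // [s hs|]; first by apply: hle; rewrite hlt.
  by move: hvu hlt; rewrite /weight !size_mnm_word => h e; rewrite e leq_add2l in h.
- by rewrite ltnNge hsz in hlt.
set w := take (size (mnm_word v)) (mnm_word u).
have szw : size w = size (mnm_word v) by rewrite size_take hlt.
have sw : spread_monomial t n d w.
  split; first by rewrite szw.
    by apply/allP => x /mem_take; apply: (allP hu2).
  exact: spread_word_take.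
have Jv : J (mnm_word v) by rewrite /J mnm_wordK; apply: generates_mem Gv; apply: (proj1 hG).
have : J w.
  apply: (dominated_stable (J := J) tspread_stable_word sv Jv sw szw) => s hs.
  by rewrite nth_take //; apply: hle.
move=> /(generates_memX _ (proj1 hG)) [g Gg gw].
have wu : (mnm_of_word n w <= u)%MM.
  apply/mnm_lepP => i; rewrite mnmE -count_mnm_word.
  by rewrite -[X in _ <= count_mem _ X](cat_take_drop (size (mnm_word v))) count_cat leq_addr.
have e := minimal_generators_antichain hG Gg Gu (lepm_trans gw wu).
have := lepm_mdeg gw; rewrite e -!size_mnm_word.
have [_ aw rw] := sw.
by rewrite (mnm_of_wordK (spread_word_sorted rw) aw) szw leqNgt hlt.
Qed.

Lemma generators_list : exists gs : seq 'X_{1..n},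
  [/\ forall u, u \in gs <-> G u, uniq gs & pairwise (fun u v => weight v <= weight u) gs].
Proof.
pose b u := sval (classically_decidable (G u)).
have bP u : G u <-> b u := svalP (classically_decidable (G u)).
pose l := [seq u <- [seq bmnm x | x : 'X_{1..n < d.+1}] | b u].
(* Degrees at most [d] leave finitely many candidates; weights decrease along the list because
   [linear_quotients] builds the ideal from its end. *)
exists (sort (fun u v => weight v <= weight u) l); split.
- move=> u; rewrite mem_sort mem_filter; split=> [/andP [/bP] //|Gu].
  apply/andP; split; first exact/bP.
  have hu : mdeg u < d.+1 by rewrite ltnS generator_mdeg.
  by apply/imageP; exists (BMultinom hu).
- rewrite sort_uniq filter_uniq // map_inj_uniq ?enum_uniq //.
  exact: val_inj.
- rewrite -sorted_pairwise; first by apply: sort_sorted => u v; apply: leq_total.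
  by move=> u v w h1 h2; apply: leq_trans h2 h1.
Qed.

Lemma generators_linear_quotients : exists2 gs : seq 'X_{1..n},
  (forall u, u \in gs <-> G u) & linear_quotients generator_vars gs.
Proof.
have [gs [hgs ugs pgs]] := generators_list; exists gs => //.
have : forall u, u \in gs -> G u by move=> u /hgs.
(* The induction runs over tails of the list and keeps the invariant that a tail contains every
   generator of smaller weight than one of its members. *)
have : forall u v, u \in gs -> G v -> weight v < weight u -> v \in gs.
  by move=> u v _ /hgs.
elim: gs {hgs} ugs pgs => //= u gs IH /andP [ugs uniq_gs] /andP [/allP ugt pgs] hinit hin.
have Gu : G u by apply: hin; rewrite inE eqxx.
have hin' v : v \in gs -> G v by move=> hv; apply: hin; rewrite inE hv orbT.
have [hu1 hu2 hu3] := generator_spread Gu.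
split.
- exact: free_vars_uniq hu3.
- apply/allP => x /mem_free_vars [s hs /andP [_ hx]].
  by apply: ltn_trans hx _; apply: (allP hu2); apply: mem_nth.
- by move=> v /ugt; apply: weight_le_mdeg.
- move=> m; split=> [/(colon_vars_lower Gu) [v [Gv hvu hv]]|[v hv vm]].
    exists v => //; have : v \in u :: gs by apply: (hinit u); rewrite ?inE ?eqxx.
    by rewrite inE => /orP [/eqP e|//]; rewrite e ltnn in hvu.
  apply: (@colon_vars_upper u v) => //; [exact: hin'| |exact: ugt].
  by move=> e; rewrite -e hv in ugs.
apply: IH => // v v' hv Gv' hlt.
have : v' \in u :: gs by apply: (hinit v); rewrite // inE hv orbT.
rewrite inE => /orP [/eqP e|//].
by have := ugt _ hv; rewrite leqNgt -e hlt.
Qed.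

Lemma size_generator_vars u : G u -> 0 < mdeg u ->
  max_var u = size (generator_vars u) + tsum t (mdeg u - 1) + 1.
Proof.
move=> Gu hu; have [_ _ su] := generator_spread Gu.
have hw : mnm_word u != [::] by rewrite -size_eq0 size_mnm_word -lt0n.
by rewrite max_varE // -(size_free_vars su hw) size_mnm_word addn0 subn1 addn1.
Qed.

Lemma betti_neq0 (F : free_resolution K n) i j :
  betti F I i j <> 0 <->
  exists u, [/\ G u, j = i + mdeg u & i <= size (generator_vars u)].
Proof.
have [gs hgs lq] := generators_linear_quotients.
have gG := proj1 hG.
have hup m : I 'X_[m] <-> upset gs m.
  rewrite (generates_memX _ gG); split=> -[u hu um]; exists u => //; exact/hgs.
rewrite (@betti_eq0 _ _ _ _ (upset gs)); last first.
  move=> p; rewrite (generates_msupp _ gG).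
  by split=> h m /h /hup.
rewrite (tor_zero_linear_quotients _ _ _ lq); split=> [h|[u [Gu e hi]] h]; last first.
  by apply: (h u); [exact/hgs|].
apply: NNPP => hne; apply: h => u /hgs Gu [e hi]; apply: hne.
by exists u; split.
Qed.

End SpreadIdeal.

(* F is an arbitrary graded free resolution of K, used to compute Tor(K, I). *)
Theorem proposition3p3 (K : fieldType) (n d : nat) (hd : (2 <= d)%N)
    (t : (d.-1).-tuple nat) (I : {mpoly K[n]} -> Prop)
    (hI : tspread_strongly_stable t I)
    (G : 'X_{1..n} -> Prop) (hG : minimal_monomial_generators I G)
    (F : free_resolution K n)
    (k l : nat) (hl1 : (1 <= l)%N) (hld : (l <= d)%N) :
  extremal_betti F I k l <->
  [/\ exists u, [/\ G u, mdeg u = l & max_var u = (k + tsum t (l - 1) + 1)%N],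
      forall u, G u -> mdeg u = l -> (max_var u <= k + tsum t (l - 1) + 1)%N
    & forall j u, (l < j)%N -> G u -> mdeg u = j ->
        (max_var u < k + tsum t (j - 1) + 1)%N].
Proof.
have [f fE] : exists f, forall u : 'X_{1..n}, f u = size (generator_vars t u).
  by exists (fun u => size (generator_vars t u)).
have maxE u : G u -> (0 < mdeg u)%N -> max_var u = (f u + tsum t (mdeg u - 1) + 1)%N.
  by rewrite fE; apply: (size_generator_vars hI hG).
have neq0 i j : betti F I i (i + j) <> 0%N <->
    exists u, [/\ G u, mdeg u = j & (i <= f u)%N].
  rewrite (betti_neq0 hI hG); split=> -[u [Gu e h]]; exists u; split=> //;
    move: h; rewrite ?fE //; lia.
have eq0 i j : betti F I i (i + j) = 0%N <-> forall u, G u -> mdeg u = j -> (f u < i)%N.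
  split=> [h u Gu e|h].
    rewrite ltnNge; apply/negP => hi.
    by case: (proj2 (neq0 i j)); first by exists u.
  apply: NNPP => /neq0 [u [Gu e hi]].
  by have := h u Gu e; rewrite ltnNge hi.
split=> [[/neq0 [u [Gu e hu]] hz]|[[u [Gu e hu]] hle hlt]].
  (* Vanishing at [(k.+1, l)] bounds [f] by [k] in degree [l], and the [u] witnessing the nonzero
     Betti number attains this bound; vanishing at [(k, j)] will give [f v < k] in degrees
     [j > l]. *)
  have hl v : G v -> mdeg v = l -> (f v <= k)%N.
    have /eq0 h : betti F I k.+1 (k.+1 + l) = 0%N by apply: hz => //; case; lia.
    by move=> Gv /(h _ Gv).
  split.
  - exists u; split=> //; rewrite maxE ?e //.
    by have := hl u Gu e; move: (f u) hu => a ha hb; lia.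
  - move=> v Gv ev; rewrite maxE ?ev //.
    by have := hl v Gv ev; lia.
  - move=> j v hj Gv ev; rewrite maxE ?ev; [|done|lia].
    have /eq0 h : betti F I k (k + j) = 0%N by apply: hz => //; [lia|case; lia].
    by have := h v Gv ev; lia.
split; first by apply/neq0; exists u; split=> //; move: hu; rewrite maxE ?e //; lia.
move=> i j hi hj hne; apply/eq0 => v Gv ev.
have hv : (0 < mdeg v)%N by lia.
(* For [j > l] one has [f v < k <= i]; for [j = l] the pair differs from [(k, l)], so
   [f v <= k < i]. *)
have [hlj|ejl] : (l < j)%N \/ l = j by move: hj; rewrite leq_eqVlt => /orP [/eqP|]; [right|left].
  by have := hlt j v hlj Gv ev; rewrite maxE // ev; lia.
have := hle v Gv; rewrite maxE // ev -ejl => /(_ erefl).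
have : k <> i by move=> e'; apply: hne; rewrite e' ejl.
lia.
Qed.
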